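(* Let $\Gamma=\langle S|R\rangle$ be a Coxeter group with its standard Coxeter generating set $S$. The word metric on $\Gamma$ with respect to $S$ is conditionally strictly negative definite if and only if $\Gamma$ is a free Coxeter group, i.e. $\Gamma=\ast_{i=1}^n\mathbb{Z}/2\mathbb{Z}$ (all coefficients $m_{s,t}=\infty$). Let $\Gamma=\langle S|R\rangle$ be an Artin group with its standard generating set $S$. The word metric on $\Gamma$ with respect to $S$ is conditionally strictly negative definite if and only if $\Gamma$ is a free group, i.e. $\Gamma=\ast_{i=1}^n\mathbb{Z}$ (all coefficients $m_{s,t}=\infty$).
   Context: A hermitian kernel $K\colon X\times X\to\mathbb{C}$ is conditionally strictly negative definite if $\sum_{x,y\in X}\lambda(x)\overline{\lambda(y)}K(x,y)<0$ for every nonzero finitely supported $\lambda\colon X\to\mathbb{C}$ with $\sum_{x}\lambda(x)=0$. For a semigroup element pair $s,t$ and $k\in\mathbb{N}$, the alternating product $\langle s,t\rangle^k$ denotes the word $stst\ldots$ of length $k$ starting with $s$. Given a set $S$ and coefficients $m_{s,t}=m_{t,s}\in\{2,3,\ldots\}\cup\{\infty\}$ for $s\neq t\in S$, the Artin group is $\langle S\mid \langle s,t\rangle^{m_{s,t}}=\langle t,s\rangle^{m_{s,t}}\ (s\neq t)\rangle$, where $m_{s,t}=\infty$ means no such relation is imposed; the corresponding Coxeter group is its quotient by the normal subgroup generated by $\{s^2:s\in S\}$. The word metric is the path metric on the Cayley graph with respect to $S$. *)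

(* Defs.v *)
From HB Require Import structures.
From mathcomp Require Import all_boot all_order all_algebra.
From mathcomp Require Import complex.
From mathcomp Require Import Rstruct.
From Stdlib Require Import ClassicalEpsilon.
Set Implicit Arguments. Unset Strict Implicit. Unset Printing Implicit Defensive.
Import Order.TTheory GRing.Theory Num.Theory.
Local Open Scope ring_scope.

Definition Cx : Type := complex Rdefinitions.R.

(* Letters over a generating set S: (false, s) is s, (true, s) is s^-1. *)
Definition letter (S : finType) : Type := (bool * S)%type.
Definition word (S : finType) : Type := seq (letter S).

Definition winv (S : finType) (w : word S) : word S :=
  rev (map (fun l => (~~ l.1, l.2)) w).

Definition alt (S : finType) (s t : S) (k : nat) : word S :=
  mkseq (fun i => (false, if odd i then t else s)) k.

(* Coefficients m_{s,t}: None encodes infinity. *)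
Definition coxeter_matrix (S : finType) (m : S -> S -> option nat) : Prop :=
  (forall s t, m s t = m t s) /\
  (forall s t k, s != t -> m s t = Some k -> (2 <= k)%N).

Definition rels (S : finType) : Type := word S -> word S -> Prop.

Definition artin_rel (S : finType) (m : S -> S -> option nat) : rels S :=
  fun l r => exists s t k, s != t /\ m s t = Some k /\ l = alt s t k /\ r = alt t s k.

Definition coxeter_rel (S : finType) (m : S -> S -> option nat) : rels S :=
  fun l r => artin_rel m l r \/ exists s, l = [:: (false, s); (false, s)] /\ r = [::].

(* Equality in the group <S | R>: the congruence on words generated by
   free reduction and the relations R. *)
Inductive weq (S : finType) (R : rels S) : word S -> word S -> Prop :=
| weq_refl w : weq R w w
| weq_sym u v : weq R u v -> weq R v u
| weq_trans u v w : weq R u v -> weq R v w -> weq R u w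
| weq_free u v b s : weq R (u ++ [:: (b, s); (~~ b, s)] ++ v) (u ++ v)
| weq_rel u v l r : R l r -> weq R (u ++ l ++ v) (u ++ r ++ v).

Definition is_wordlen (S : finType) (R : rels S) (g : word S) (n : nat) : Prop :=
  (exists w, size w = n /\ weq R w g) /\ (forall w, weq R w g -> (n <= size w)%N).

Definition wordlen (S : finType) (R : rels S) (g : word S) : nat :=
  epsilon (inhabits 0%N) (is_wordlen R g).

Definition word_dist (S : finType) (R : rels S) (x y : word S) : nat :=
  wordlen R (winv x ++ y).

(* The word metric on <S | R> is conditionally strictly negative definite:
   for every nonzero finitely supported lambda (given by finitely many pairwise
   distinct group elements x_i with coefficients lambda_i) with sum zero,
   sum_{i,j} lambda_i conj(lambda_j) d(x_i, x_j) < 0. *)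
Definition word_metric_CSND (S : finType) (R : rels S) : Prop :=
  forall (n : nat) (x : 'I_n -> word S) (lam : 'I_n -> Cx),
    (forall i j, i != j -> ~ weq R (x i) (x j)) ->
    \sum_(i < n) lam i = 0 ->
    (exists i, lam i != 0) ->
    \sum_(i < n) \sum_(j < n) lam i * Num.conj (lam j) * (word_dist R (x i) (x j))%:R < 0.

Definition all_infinite (S : finType) (m : S -> S -> option nat) : Prop :=
  forall s t, s != t -> m s t = None.

(* Main.v *)
Require Import Defs.
From Stdlib Require Import ClassicalEpsilon.
From HB Require Import structures.
From mathcomp Require Import all_boot all_order all_algebra all_field.
From mathcomp Require Import boolp complex Rstruct ring zify.

(** Consider a family of cuts of a group into two parts such that each edge of the
    Cayley graph crosses at most one of them. The number of cuts separating two elements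
    is at most their distance; where it is equal to the distance, the quadratic form is
    [-2 \sum_p |\sum_(x_i in p) lam i|^2] as soon as [\sum_i lam i = 0].

    If all coefficients are infinite, the Cayley graph is a tree and the cuts given by
    its edges compute the distance. The form is then negative: the edge that leads to a
    longest word of the support cuts off this word alone.

    If [m s t = k] is finite, the words in [s] and [t] contain two pairs of antipodes of
    a [2k]-cycle, on which the weights [+1, -1, +1, -1] give a nonnegative value; the
    same positive words work in the Artin group, because lengths do not increase in the
    Coxeter quotient. What has to be proved is that the alternating word of length [k]
    is geodesic in the Coxeter group. There the cuts are the walls of a reflection
    representation: the parity of the number of times a word crosses a given root, up to
    sign, depends only on the group element, and the alternating word crosses [k]
    distinct walls once each. They are distinct because the form pairs [s] and [t] to
    [- (z + z^-1)] for a primitive [2k]-th root of unity [z], that is, to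
    [- 2 cos (pi / k)], and some linear functional maps the [k] roots to the multiples of
    [1], [z^-1], ..., [z ^- k.-1] by a nonzero constant. *)

Set Implicit Arguments. Unset Strict Implicit. Unset Printing Implicit Defensive.
Import GRing.Theory Num.Theory.
Local Open Scope ring_scope.

(** * Counting the cuts that separate two points *)

Section Separation.
Variables (I T : Type) (cut : I -> T -> bool) (P : seq I).
Implicit Types x y z : T.

Definition separation x y := count (fun p => cut p x (+) cut p y) P.

Lemma separationxx x : separation x x = 0%N.
Proof.
by rewrite /separation (eq_count (a2 := pred0)) ?count_pred0 // => p /=; rewrite addbb.
Qed.

Lemma separationC x y : separation x y = separation y x.
Proof. by apply: eq_count => p; rewrite addbC. Qed.

Lemma separation_triangle y x z : (separation x z <= separation x y + separation y z)%N.
Proof.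
rewrite -count_predUI (leq_trans _ (leq_addr _ _)) // sub_count // => p /=.
by case: (cut p x); case: (cut p y); case: (cut p z).
Qed.

End Separation.

Section CutForms.
Variables (C : numClosedFieldType) (J : finType) (lam : J -> C).
Hypothesis sum_lam : \sum_i lam i = 0.

Lemma cut_form (a : J -> bool) :
  \sum_i \sum_j lam i * (lam j)^* * (a i (+) a j)%:R
  = - (2 * `|\sum_i lam i * (a i)%:R| ^+ 2).
Proof.
have sum_conj : \sum_i (lam i)^* = 0 by rewrite -rmorph_sum sum_lam rmorph0.
have addbE i j :
    (a i (+) a j)%:R = (a i)%:R + (a j)%:R - 2 * ((a i)%:R * (a j)%:R) :> C.
  by case: (a i); case: (a j) => /=; ring.
transitivity (\sum_i \sum_j
    (lam i * (a i)%:R * (lam j)^* + lam i * ((lam j)^* * (a j)%:R)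
     - 2 * (lam i * (a i)%:R * (lam j * (a j)%:R)^*))).
  apply: eq_bigr => i _; apply: eq_bigr => j _.
  by rewrite addbE rmorphM rmorph_nat; ring.
under eq_bigr => i _ do rewrite sumrB big_split /= -!mulr_sumr sum_conj mulr0 add0r.
rewrite sumrB -mulr_suml sum_lam mul0r sub0r -mulr_sumr; congr (- (2 * _)).
by rewrite normCK rmorph_sum mulr_suml.
Qed.

Lemma separation_form (I T : Type) (cut : I -> T -> bool) (P : seq I) (x : J -> T) :
  \sum_i \sum_j lam i * (lam j)^* * (separation cut P (x i) (x j))%:R
  = - (2 * \sum_(p <- P) `|\sum_i lam i * (cut p (x i))%:R| ^+ 2).
Proof.
transitivity (\sum_(p <- P) \sum_i \sum_j
    lam i * (lam j)^* * (cut p (x i) (+) cut p (x j))%:R).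
  rewrite [RHS]exchange_big; apply: eq_bigr => i _; rewrite [RHS]exchange_big.
  apply: eq_bigr => j _; rewrite -mulr_sumr; congr (_ * _).
  by rewrite -natr_sum /separation -sumn_count sumnE big_map.
by under eq_bigr do rewrite cut_form; rewrite sumrN -mulr_sumr.
Qed.

Lemma separation_form_lt0 (I : eqType) (T : Type) (cut : I -> T -> bool) (P : seq I)
    (x : J -> T) p :
  p \in P -> \sum_i lam i * (cut p (x i))%:R != 0 ->
  \sum_i \sum_j lam i * (lam j)^* * (separation cut P (x i) (x j))%:R < 0.
Proof.
move=> pP p_neq0; rewrite separation_form oppr_lt0 mulr_gt0 ?ltr0n //.
rewrite (big_rem _ pP) /= ltr_pwDl ?exprn_gt0 ?normr_gt0 // sumr_ge0 //.
by move=> q _; rewrite exprn_ge0.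
Qed.

End CutForms.

Lemma count_le1 (T : eqType) (a : pred T) (s : seq T) :
  uniq s -> {in s &, forall x y, a x -> a y -> x = y} -> (count a s <= 1)%N.
Proof.
move=> s_uniq a_inj; rewrite -size_filter; case Ds: (filter a s) => [//|x r].
apply: (@uniq_leq_size _ _ [:: x]) => [|y].
  by rewrite -Ds filter_uniq.
have : x \in filter a s by rewrite Ds mem_head.
rewrite -Ds !mem_filter inE => /andP[ax xs] /andP[ay ys].
by rewrite (a_inj x y).
Qed.

(** * The word metric *)

Section WordMetric.
Variables (S : finType) (R : rels S).
Implicit Types u v w x y z : word S.

Lemma winv_cat u v : winv (u ++ v) = winv v ++ winv u.
Proof. by rewrite /winv map_cat rev_cat. Qed.

Lemma winvK : involutive (@winv S).
Proof.
move=> u; rewrite /winv map_rev revK -map_comp -[RHS]map_id.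
by apply: eq_map => -[e s] /=; rewrite negbK.
Qed.

Lemma size_winv u : size (winv u) = size u.
Proof. by rewrite /winv size_rev size_map. Qed.

Lemma weq_ctx p q u v : weq R u v -> weq R (p ++ u ++ q) (p ++ v ++ q).
Proof.
elim=> {u v} [w|u v _|u v w _ uv _|u v e s|u v l r lr].
- exact: weq_refl.
- exact: weq_sym.
- exact: weq_trans uv.
- by have := weq_free R (p ++ u) (v ++ q) e s; rewrite -!catA.
- by have := weq_rel (p ++ u) (v ++ q) lr; rewrite -!catA.
Qed.

Lemma weq_catl p u v : weq R u v -> weq R (p ++ u) (p ++ v).
Proof. by move/(weq_ctx p [::]); rewrite !cats0. Qed.

Lemma weq_catr q u v : weq R u v -> weq R (u ++ q) (v ++ q).
Proof. exact: (weq_ctx [::] q). Qed.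

Lemma weq_cat_winv u : weq R (u ++ winv u) [::].
Proof.
elim/last_ind: u => [|u [e s] ih]; first exact: weq_refl.
rewrite -cats1 winv_cat -catA; exact: weq_trans (weq_free R u (winv u) e s) ih.
Qed.

Lemma weq_winvK x y : weq R (x ++ winv x ++ y) y.
Proof. rewrite catA; exact: weq_catr (weq_cat_winv x). Qed.

Lemma weq_path_inv x y w : weq R (x ++ w) y -> weq R (y ++ winv w) x.
Proof.
move=> xwy; apply: weq_trans (weq_catr _ (weq_sym xwy)) _.
by rewrite -catA -[X in weq R _ X]cats0; apply: weq_catl; exact: weq_cat_winv.
Qed.

Lemma is_wordlen_wordlen g : is_wordlen R g (wordlen R g).
Proof.
apply: epsilon_spec.
have some_size : exists n, `[< exists w, size w = n /\ weq R w g >].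
  by exists (size g); apply/asboolP; exists g; split=> //; exact: weq_refl.
case: (ex_minnP some_size) => n /asboolP n_size n_min; exists n; split=> // w w_g.
by apply: n_min; apply/asboolP; exists w.
Qed.

Lemma word_dist_geodesic x y :
  exists2 w, weq R (x ++ w) y & size w = word_dist R x y.
Proof.
have [[w [size_w w_xy]] _] := is_wordlen_wordlen (winv x ++ y).
by exists w => //; exact: weq_trans (weq_catl x w_xy) (weq_winvK x y).
Qed.

Lemma word_dist_le x y w : weq R (x ++ w) y -> (word_dist R x y <= size w)%N.
Proof.
move=> xw_y; have [_] := is_wordlen_wordlen (winv x ++ y); apply.
apply: weq_trans (weq_catl _ xw_y); apply: weq_sym.
by rewrite -{2}[x]winvK; exact: weq_winvK.
Qed.

Lemma word_dist_weq0 x y : weq R x y -> word_dist R x y = 0%N.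
Proof. by move=> xy; apply/eqP; rewrite -leqn0 (@word_dist_le _ _ [::]) ?cats0. Qed.

Lemma word_distxx x : word_dist R x x = 0%N.
Proof. exact/word_dist_weq0/weq_refl. Qed.

Lemma word_distC x y : word_dist R x y = word_dist R y x.
Proof.
suff le_dist x' y' : (word_dist R y' x' <= word_dist R x' y')%N.
  by apply/eqP; rewrite eqn_leq !le_dist.
have [w /weq_path_inv yw_x <-] := word_dist_geodesic x' y'.
by rewrite -size_winv word_dist_le.
Qed.

Lemma word_dist_triangle y x z :
  (word_dist R x z <= word_dist R x y + word_dist R y z)%N.
Proof.
have [u xu_y <-] := word_dist_geodesic x y; have [v yv_z <-] := word_dist_geodesic y z.
rewrite -size_cat word_dist_le // catA; exact: weq_trans (weq_catr v xu_y) yv_z.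
Qed.

Lemma word_dist_weq x x' y y' :
  weq R x x' -> weq R y y' -> word_dist R x y = word_dist R x' y'.
Proof.
suff le_dist u u' v v' : weq R u u' -> weq R v v' ->
    (word_dist R u v <= word_dist R u' v')%N.
  by move=> xx' yy'; apply/eqP; rewrite eqn_leq !le_dist //; exact: weq_sym.
move=> /word_dist_weq0 uu' /weq_sym/word_dist_weq0 v'v.
rewrite (leq_trans (word_dist_triangle u' u v)) // uu' add0n.
by rewrite (leq_trans (word_dist_triangle v' u' v)) // v'v addn0.
Qed.

Lemma word_dist_catl p x y : word_dist R (p ++ x) (p ++ y) = word_dist R x y.
Proof.
have catl_le q x' y' : (word_dist R (q ++ x') (q ++ y') <= word_dist R x' y')%N.
  have [w xw_y <-] := word_dist_geodesic x' y'.
  by apply: word_dist_le; rewrite -catA; exact: weq_catl.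
apply/eqP; rewrite eqn_leq catl_le.
have winv_catK z : weq R z (winv p ++ p ++ z).
  by rewrite -{2}[p]winvK; apply: weq_sym; exact: weq_winvK.
by rewrite (word_dist_weq (winv_catK x) (winv_catK y)) catl_le.
Qed.

End WordMetric.

Definition sub_rels (S : finType) (R R' : rels S) : Prop :=
  forall l r, R l r -> R' l r.

Lemma weq_mono (S : finType) (R R' : rels S) u v :
  sub_rels R R' -> weq R u v -> weq R' u v.
Proof.
move=> RR'; elim=> {u v}.
- exact: weq_refl.
- by move=> u v _; exact: weq_sym.
- by move=> u v w _ uv _ vw; exact: weq_trans uv vw.
- exact: weq_free.
- by move=> u v l r /RR'; exact: weq_rel.
Qed.

Lemma word_dist_mono (S : finType) (R R' : rels S) x y :
  sub_rels R R' -> (word_dist R' x y <= word_dist R x y)%N.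
Proof.
move=> RR'; have [w xw_y <-] := word_dist_geodesic R x y.
exact/word_dist_le/(weq_mono RR').
Qed.

Lemma separation_le_word_dist (S : finType) (R : rels S) (I : Type)
    (cut : I -> word S -> bool) (P : seq I) x y :
  (forall p u v, weq R u v -> cut p u = cut p v) ->
  (forall w l, separation cut P w (rcons w l) <= 1)%N ->
  (separation cut P x y <= word_dist R x y)%N.
Proof.
move=> cut_weq cut_step; have [w xw_y <-] := word_dist_geodesic R x y.
have -> : separation cut P x y = separation cut P x (x ++ w).
  by apply: eq_count => p; rewrite (cut_weq p _ _ xw_y).
elim/last_ind: w {xw_y} => [|w l ih]; first by rewrite cats0 separationxx.
rewrite size_rcons -rcons_cat -addn1.
by rewrite (leq_trans (separation_triangle _ _ (x ++ w) _ _)) // leq_add.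
Qed.

(** * Suffix cuts *)

Section SuffixCuts.
Variable A : eqType.
Implicit Types (X Y p : seq A) (P : seq (seq A)).

Definition suffixes X := [seq drop k X | k <- iota 0 (size X).+1].

Lemma mem_suffixes p X : (p \in suffixes X) = suffix p X.
Proof.
apply/mapP/idP => [[k _ ->]|]; first exact: suffix_drop.
rewrite suffixE => /eqP <-; exists (size X - size p)%N => //.
by rewrite mem_iota ltnS leq_subr.
Qed.

Lemma suffix_eq_cons p a X : suffix p (a :: X) = (p == a :: X) || suffix p X.
Proof.
apply/suffixP/orP => [[[|b z] /= E]|[/eqP->|/suffixP[z ->]]].
- by left; rewrite E.
- by right; case: E => _ ->; exact: suffix_suffix.
- by exists [::].
- by exists (a :: z).
Qed.

Lemma suffix_size_eq X Y : suffix X Y -> (size Y <= size X)%N -> X = Y.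
Proof.
by case/suffixP=> z ->; rewrite size_cat -[leqRHS]add0n leq_add2r leqn0 => /nilP ->.
Qed.

Lemma separation_suffix_cons_le1 P a X :
  uniq P -> (separation (@suffix A) P X (a :: X) <= 1)%N.
Proof.
have cons_only p : suffix p X (+) suffix p (a :: X) -> p = a :: X.
  by rewrite suffix_eq_cons; case: eqP => //= _; rewrite addbb.
by move=> P_uniq; apply: count_le1 => // p q _ _ /cons_only -> /cons_only ->.
Qed.

Lemma separation_suffix_cons P a X Y : uniq P -> a :: X \in P ->
  ~~ suffix (a :: X) Y ->
  separation (@suffix A) P (a :: X) Y = (separation (@suffix A) P X Y).+1.
Proof.
move=> P_uniq aX_P /negbTE aXY; set p := a :: X in aX_P aXY *.
have pX : suffix p X = false by apply/negP => /size_suffix; rewrite ltnn.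
have := count_predUI (pred1 p) (fun q => suffix q X (+) suffix q Y) P.
rewrite count_uniq_mem // aX_P [X in (_ + X)%N](_ : _ = 0%N) ?addn0.
  move=> countU; apply: etrans countU; apply: eq_count => q /=.
  rewrite suffix_eq_cons -/p.
  by case: eqP => [->|//]; rewrite aXY.
rewrite -[RHS](count_pred0 P); apply: eq_count => q /=.
by case: eqP => //= ->; rewrite pX aXY.
Qed.

Lemma longest_support_weight (C : numDomainType) (J : finType) (X : J -> seq A)
    (lam : J -> C) :
  injective X -> (exists i, lam i != 0) ->
  exists i, \sum_j lam j * (suffix (X i) (X j))%:R != 0.
Proof.
move=> X_inj [i0 lam_i0].
have [i lam_i i_max] :=
  arg_maxnP (P := fun i => lam i != 0) (fun i => size (X i)) lam_i0.
exists i.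
rewrite (bigD1 i) //= suffix_refl mulr1 big1 ?addr0 // => j j_i.
have [->|lam_j] := eqVneq (lam j) 0; first by rewrite mul0r.
case: (boolP (suffix _ _)) => [ij|]; last by rewrite mulr0.
by rewrite (X_inj _ _ (suffix_size_eq ij (i_max _ lam_j))) eqxx in j_i.
Qed.

End SuffixCuts.

(** * Free reduction *)

Section FreeReduction.
Variables (A : eqType) (inv : A -> A).
Implicit Types (a b : A) (y : seq A).

Definition push y a :=
  if y is b :: y' then if b == inv a then y' else a :: y else [:: a].

Definition reduced y := sorted (fun a b => b != inv a) y.

Lemma push_reduced y a : reduced y -> reduced (push y a).
Proof.
case: y => //= b y by_red; case: ifPn => [_|ba]; first exact: path_sorted by_red.
by rewrite /= ba.
Qed.

Lemma foldl_push_reduced y w : reduced y -> reduced (foldl push y w).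
Proof. by elim: w y => //= a w ih y /push_reduced -/(_ a); exact: ih. Qed.

Lemma pushK y a : involutive inv -> reduced y -> push (push y a) (inv a) = y.
Proof.
move=> invK; case: y => [|b y] /=; first by rewrite invK eqxx.
case: (eqVneq b (inv a)) => [->|_] /=; last by rewrite invK eqxx.
by case: y => [|c y] //= /andP[/negbTE ->].
Qed.

Lemma push_cases y a : push y a = a :: y \/ y = inv a :: push y a.
Proof.
case: y => [|b y] /=; first by left.
by case: eqP => [->|_]; [right|left].
Qed.

End FreeReduction.

(** * Groups with free normal forms *)

(* The Cayley graph is a tree: [A] is the alphabet of monoid generators, namely
   signed letters for a free group and [S] itself for a free product of groups of
   order two. The normal form [nf w] is stored with its last letter first, so that
   multiplying by a letter on the right is a [push], and the edges on the path from
   the base point to [w] are the nonempty suffixes of [nf w]. *)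
Section FreeNormalForm.
Variables (S : finType) (R : rels S) (A : eqType) (inv : A -> A).
Variables (code : letter S -> A) (decode : A -> letter S).
Hypothesis invK : involutive inv.
Hypothesis codeK : forall l, weq R [:: decode (code l)] [:: l].
Hypothesis code_inv : forall l, code (~~ l.1, l.2) = inv (code l).
Hypothesis push_rel : forall l r y, R l r -> reduced inv y ->
  foldl (push inv) y (map code l) = foldl (push inv) y (map code r).
Implicit Types (w x y : word S) (X Y : seq A).

Definition nf w := foldl (push inv) [::] (map code w).

Definition spell X : word S := map decode (rev X).

Lemma nf_cat u v : nf (u ++ v) = foldl (push inv) (nf u) (map code v).
Proof. by rewrite /nf map_cat foldl_cat. Qed.

Lemma nf_rcons w l : nf (rcons w l) = push inv (nf w) (code l).
Proof. by rewrite -cats1 nf_cat. Qed.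

Lemma nf_reduced w : reduced inv (nf w).
Proof. exact: foldl_push_reduced. Qed.

Lemma nf_weq u v : weq R u v -> nf u = nf v.
Proof.
elim=> {u v} // [u v w _ -> _ -> //|u v e s|u v l r lr].
- by rewrite !nf_cat map_cat foldl_cat /= (code_inv (e, s)) pushK //; exact: nf_reduced.
- by rewrite !nf_cat !map_cat !foldl_cat (push_rel lr) //; exact: nf_reduced.
Qed.

Lemma spell_cons a X : spell (a :: X) = rcons (spell X) (decode a).
Proof. by rewrite /spell rev_cons map_rcons. Qed.

Lemma weq_spell_push X l : weq R (spell (push inv X (code l))) (rcons (spell X) l).
Proof.
have weq_decode w l' : weq R (rcons w (decode (code l'))) (rcons w l').
  by rewrite -!cats1; apply: weq_catl.
case: (push_cases inv X (code l)) => [->|]; first by rewrite spell_cons.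
move: (push _ _ _) => Y ->; rewrite spell_cons -code_inv.
have := weq_free R (spell Y) [::] (~~ l.1) l.2.
rewrite negbK -surjective_pairing !cats0 => /weq_sym cancel; apply: weq_trans cancel _.
by rewrite -cat_rcons -[X in weq R _ X]cats1; apply/weq_catr/weq_sym.
Qed.

Lemma weq_spell_nf w : weq R (spell (nf w)) w.
Proof.
elim/last_ind: w => [|w l ih]; first exact: weq_refl.
rewrite nf_rcons; apply: weq_trans (weq_spell_push _ _) _.
by rewrite -!cats1; exact: weq_catr.
Qed.

Lemma separation_nf_le_word_dist (P : seq (seq A)) x y :
  uniq P -> (separation (@suffix A) P (nf x) (nf y) <= word_dist R x y)%N.
Proof.
move=> P_uniq.
apply: (separation_le_word_dist (cut := fun p w => suffix p (nf w))) => [p u v|w l].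
  by move=> /nf_weq ->.
rewrite -[separation _ _ _ _]/(separation (@suffix A) P (nf w) (nf (rcons w l))).
rewrite nf_rcons.
case: (push_cases inv (nf w) (code l)) => [->|{1}->].
  exact: separation_suffix_cons_le1.
by rewrite separationC separation_suffix_cons_le1.
Qed.

Lemma word_dist_spell_le (P : seq (seq A)) X Y : uniq P ->
  (forall p, suffix p X -> p \in P) -> (forall p, suffix p Y -> p \in P) ->
  (word_dist R (spell X) (spell Y) <= separation (@suffix A) P X Y)%N.
Proof.
move=> P_uniq; have [n] := ubnP (size X + size Y).
elim: n X Y => [//|n ih] X Y; wlog YX : X Y / (size Y <= size X)%N.
  move=> wlog_le; case/orP: (leq_total (size Y) (size X)) => YX; first exact: wlog_le.
  by rewrite addnC word_distC separationC => lt_n XP YP; apply: wlog_le.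
move=> lt_n XP YP; have [/suffix_size_eq -> //|XY] := boolP (suffix X Y).
  by rewrite word_distxx.
case: X => [|a X] in YX lt_n XP XY *; first by rewrite suffix0s in XY.
rewrite separation_suffix_cons ?XP ?suffix_refl // -add1n.
rewrite (leq_trans (word_dist_triangle R (spell X) _ _)) // leq_add //; last first.
  by apply: ih => // p pX; apply: XP; rewrite suffix_eq_cons pX orbT.
rewrite word_distC spell_cons -cats1; apply: (word_dist_le (w := [:: _])).
exact: weq_refl.
Qed.

Lemma word_dist_nf (P : seq (seq A)) x y : uniq P ->
  (forall p, suffix p (nf x) -> p \in P) -> (forall p, suffix p (nf y) -> p \in P) ->
  word_dist R x y = separation (@suffix A) P (nf x) (nf y).
Proof.
move=> P_uniq xP yP; apply/eqP; rewrite eqn_leq separation_nf_le_word_dist // andbT.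
rewrite -(word_dist_weq (weq_spell_nf x) (weq_spell_nf y)).
exact: word_dist_spell_le.
Qed.

Lemma free_normal_form_CSND : word_metric_CSND R.
Proof.
move=> n x lam x_distinct sum_lam lam_neq0.
pose X i := nf (x i); pose P := undup (flatten [seq suffixes (X i) | i <- enum 'I_n]).
have XP i p : suffix p (X i) -> p \in P.
  rewrite -mem_suffixes mem_undup => pX; apply/flattenP; exists (suffixes (X i)) => //.
  by apply: map_f; rewrite mem_enum.
have X_inj : injective X.
  move=> i j Xij; have [//|/x_distinct[]] := eqVneq i j.
  apply: weq_trans (weq_sym (weq_spell_nf _)) _; rewrite -/(X i) Xij.
  exact: weq_spell_nf.
have [i Xi_neq0] := longest_support_weight X_inj lam_neq0.
under eq_bigr do under eq_bigr do
  rewrite (word_dist_nf (undup_uniq _) (XP _) (XP _)).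
exact: (separation_form_lt0 sum_lam (XP i _ (suffix_refl _)) Xi_neq0).
Qed.

End FreeNormalForm.

(** * Artin and Coxeter presentations *)

Lemma altS (S : finType) (s t : S) k : alt s t k.+1 = (false, s) :: alt t s k.
Proof.
rewrite /alt /mkseq /= -[1%N]/(1 + 0)%N iotaDl -map_comp; congr (_ :: _).
by apply: eq_map => i /=; case: (odd i).
Qed.

Lemma alt_rcons (S : finType) (s t : S) k :
  alt s t k.+1 = rcons (alt s t k) (false, if odd k then t else s).
Proof. by rewrite /alt mkseqS. Qed.

Lemma size_alt (S : finType) (s t : S) k : size (alt s t k) = k.
Proof. by rewrite size_mkseq. Qed.

Section Presentations.
Variables (S : finType) (m : S -> S -> option nat).

Lemma weq_generator_sqr s : weq (coxeter_rel m) [:: (false, s); (false, s)] [::].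
Proof.
have sqr_rel : coxeter_rel m [:: (false, s); (false, s)] [::] by right; exists s.
exact: (weq_rel [::] [::] sqr_rel).
Qed.

Lemma weq_generator_inv s : weq (coxeter_rel m) [:: (false, s)] [:: (true, s)].
Proof.
apply: weq_trans (weq_sym (weq_free _ [:: (false, s)] [::] false s)) _.
exact: (weq_catr [:: (true, s)] (weq_generator_sqr s)).
Qed.

Lemma free_artin_CSND : all_infinite m -> word_metric_CSND (artin_rel m).
Proof.
move=> m_inf; apply: (free_normal_form_CSND (inv := fun l => (~~ l.1, l.2))
    (code := id) (decode := id)) => //.
- by case=> e s; rewrite /= negbK.
- by move=> l; exact: weq_refl.
- by move=> l r y [s [t [k [/m_inf -> [//]]]]].
Qed.

Lemma free_coxeter_CSND : all_infinite m -> word_metric_CSND (coxeter_rel m).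
Proof.
move=> m_inf; apply: (free_normal_form_CSND (inv := id) (code := snd)
    (decode := pair false)) => //.
- by case=> -[] s; [exact: weq_generator_inv|exact: weq_refl].
- move=> l r y [[s [t [k [/m_inf -> [//]]]]]|[s [-> ->]]] y_red.
  exact: (pushK (inv := id)).
Qed.

End Presentations.

(** * Quantum integers at a root of unity *)

Section QuantumIntegers.
Variables (F : fieldType) (z : F) (k : nat).
Hypothesis z_prim : (k.*2).-primitive_root z.

Lemma prim_root_half : z ^+ k = -1.
Proof.
have k_gt0 : (0 < k)%N by rewrite -double_gt0 (prim_order_gt0 z_prim).
have : (z ^+ k) ^+ 2 == 1 by rewrite -exprM muln2 prim_expr_order.
rewrite sqrf_eq1 -(prim_order_dvd z_prim) => /orP[|/eqP//].
by move/(dvdn_leq k_gt0); lia.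
Qed.

Lemma prim_root_expV_inj i j : (i < k)%N -> (j < k)%N ->
  z ^- i = z ^- j \/ z ^- i = - z ^- j -> i = j.
Proof.
move=> ik jk eq_ij; have : (z ^- i) ^+ 2 = (z ^- j) ^+ 2.
  by case: eq_ij => ->; rewrite ?sqrrN.
rewrite !exprVn => /invr_inj/eqP; rewrite -!exprM (eq_prim_root_expr z_prim).
rewrite !modn_small; lia.
Qed.

Hypothesis k_gt1 : (1 < k)%N.

(* For [z = exp (i pi / k)] this is [sin (i pi / k) / sin (pi / k)]. *)
Definition qint (i : nat) : F := (z ^+ i - z ^- i) / (z - z^-1).

Let z_neq0 : z != 0.
Proof. by rewrite (prim_root_eq0 z_prim); lia. Qed.

Lemma prim_root_subV_neq0 : z - z^-1 != 0.
Proof.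
rewrite subr_eq0; apply: contraTneq k_gt1 => zV.
have : z ^+ 2 == 1 by rewrite expr2 {2}zV divff ?z_neq0.
by rewrite -(prim_order_dvd z_prim) => /(@dvdn_leq _ 2 isT); lia.
Qed.

Lemma qint0 : qint 0 = 0.
Proof. by rewrite /qint expr0 invr1 subrr mul0r. Qed.

Lemma qint1 : qint 1 = 1.
Proof. by rewrite /qint expr1 divff ?prim_root_subV_neq0. Qed.

Lemma qintK i : qint i * (z - z^-1) = z ^+ i - z ^- i.
Proof. exact: divfK prim_root_subV_neq0 _. Qed.

Lemma qintSS i : qint i.+2 = (z + z^-1) * qint i.+1 - qint i.
Proof.
apply: (mulIf prim_root_subV_neq0).
rewrite [RHS]mulrBl -[in RHS]mulrA !qintK !exprS !invfM.
by field; rewrite expf_neq0 z_neq0.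
Qed.

Lemma qint_expV i : qint i.+1 - z * qint i = z ^- i.
Proof.
apply: (mulIf prim_root_subV_neq0); rewrite mulrBl -[_ * qint i * _]mulrA.
by rewrite !qintK exprS invfM; field; rewrite expf_neq0 z_neq0.
Qed.

Lemma qintD_half i : qint (k + i) = - qint i.
Proof.
apply: (mulIf prim_root_subV_neq0).
by rewrite mulNr !qintK exprD prim_root_half invfM invrN1; ring.
Qed.

Lemma qintB_half i : (i <= k)%N -> qint (k - i) = qint i.
Proof.
move=> ik; apply: (mulIf prim_root_subV_neq0); rewrite !qintK expfB_cond; last first.
  by rewrite (negbTE z_neq0).
by rewrite prim_root_half invfM invrK invrN1; ring.
Qed.

End QuantumIntegers.

(** * Crossing parities in reflection representations *)

Section Reflections.
Variables (F : fieldType) (V : lmodType F) (S : finType).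
Variables (root : S -> V) (coroot : S -> {scalar V}).
Hypothesis coroot_root : forall s, coroot s (root s) = 2.
Implicit Types (s t : S) (u v w : word S) (x y : V) (a : pred V).

Definition refl s x := x - coroot s x *: root s.

Fact refl_linear s : linear (refl s).
Proof.
move=> c x y; rewrite /refl linearP /= scalerDl scalerBr scalerA opprD !addrA.
by congr (_ - _); rewrite addrAC.
Qed.

HB.instance Definition _ s := GRing.isLinear.Build F V V *:%R (refl s) (refl_linear s).

Definition act w x := foldr (fun l => refl l.2) x w.

Fact act_linear w : linear (act w).
Proof. by elim: w => // l w ih c x y; rewrite /= ih linearP. Qed.

HB.instance Definition _ w := GRing.isLinear.Build F V V *:%R (act w) (act_linear w).

Lemma refl_root s : refl s (root s) = - root s.
Proof. by rewrite /refl coroot_root scaler_nat mulr2n opprD addNKr. Qed.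

Lemma reflK s : involutive (refl s).
Proof.
by move=> x; rewrite {2}/refl linearB linearZ /= refl_root scalerN opprK subrK.
Qed.

Lemma act_cat u v x : act (u ++ v) x = act u (act v x).
Proof. by rewrite /act foldr_cat. Qed.

(* The roots [s_1 ... s_(i-1) root_(s_i)] of the walls crossed by the gallery [w]. *)
Fixpoint crossed w : seq V :=
  if w is l :: w' then root l.2 :: map (refl l.2) (crossed w') else [::].

Lemma crossed_cat u v : crossed (u ++ v) = crossed u ++ map (act u) (crossed v).
Proof.
elim: u => /= [|l u ->]; first by rewrite map_id_in.
by rewrite map_cat -map_comp.
Qed.

(* A wall is a root up to sign, so a set of walls is a sign-invariant predicate. *)
Definition crossing_parity a w := odd (count a (crossed w)).

Definition sign_invariant a := forall x, a (- x) = a x.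

Lemma crossing_parity_cat a u v :
  crossing_parity a (u ++ v) = crossing_parity a u (+) crossing_parity (a \o act u) v.
Proof. by rewrite /crossing_parity crossed_cat count_cat count_map oddD. Qed.

Lemma crossing_parity_rcons a w l :
  crossing_parity a (rcons w l) = crossing_parity a w (+) a (act w (root l.2)).
Proof. by rewrite -cats1 crossing_parity_cat /crossing_parity /= addn0 oddb. Qed.

Lemma crossing_parity_ctx a u l r v : sign_invariant a -> act l =1 act r ->
  (forall a', sign_invariant a' -> crossing_parity a' l = crossing_parity a' r) ->
  crossing_parity a (u ++ l ++ v) = crossing_parity a (u ++ r ++ v).
Proof.
move=> a_sign act_lr parity_lr; rewrite !crossing_parity_cat parity_lr.
  congr (_ (+) (_ (+) odd _)); apply: eq_count => x /=.
  by rewrite act_lr.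
by move=> x /=; rewrite linearN a_sign.
Qed.

Lemma crossing_parity_square a u l l' v : sign_invariant a -> l.2 = l'.2 ->
  crossing_parity a (u ++ [:: l; l'] ++ v) = crossing_parity a (u ++ v).
Proof.
move=> a_sign ll'; apply: (@crossing_parity_ctx _ _ _ [::]) => // [x|a' a'_sign].
  by rewrite /= ll' reflK.
by rewrite /crossing_parity /= ll' refl_root a'_sign addn0 addnn odd_double.
Qed.

Definition up_to_sign x y := (y == x) || (y == - x).

Lemma up_to_sign_invariant x : sign_invariant (up_to_sign x).
Proof. by move=> y; rewrite /up_to_sign eqr_oppLR eqr_opp orbC. Qed.

Lemma up_to_sign_common x y r : up_to_sign x r -> up_to_sign y r -> up_to_sign x y.
Proof.
by case/orP=> /eqP->; rewrite /up_to_sign ![y == _]eq_sym eqr_oppLR // eqr_opp orbC.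
Qed.

Section Dihedral.
Variables (z : F) (k : nat).
Hypothesis k_gt1 : (1 < k)%N.
Hypothesis z_prim : (k.*2).-primitive_root z.
Local Notation qint := (qint z).
Let z_neq0 : z != 0. Proof. by rewrite (prim_root_eq0 z_prim); lia. Qed.
Let zV_neq0 : z - z^-1 != 0. Proof. exact: (prim_root_subV_neq0 z_prim). Qed.

Definition dihedral_pair s t :=
  coroot s (root t) = - (z + z^-1) /\ coroot t (root s) = - (z + z^-1).

Definition dihedral_root s t i := qint i.+1 *: root s + qint i *: root t.

Lemma dihedral_pairC s t : dihedral_pair s t -> dihedral_pair t s.
Proof. by case. Qed.

Lemma coroot_dihedral_root s t i : dihedral_pair s t ->
  coroot s (dihedral_root t s i) = qint i - qint i.+2.
Proof.
case=> coroot_st _; rewrite /dihedral_root linearD !scalarZ /= coroot_root coroot_st.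
by rewrite (qintSS z_prim k_gt1); ring.
Qed.

Lemma refl_dihedral_root s t i :
  dihedral_pair s t -> refl s (dihedral_root t s i) = dihedral_root s t i.+1.
Proof.
move=> st; rewrite /refl coroot_dihedral_root // scalerBl /dihedral_root.
by rewrite opprB addrA addrAC addrK addrC.
Qed.

Lemma act_alt_root s t i : dihedral_pair s t ->
  act (alt s t i) (root (if odd i then t else s)) = dihedral_root s t i.
Proof.
elim: i s t => [|i ih] s t st.
  by rewrite /= /dihedral_root (qint1 z_prim k_gt1) qint0 scale1r scale0r addr0.
by rewrite altS /= if_neg ih ?refl_dihedral_root //; exact: dihedral_pairC.
Qed.

Lemma crossed_alt s t i :
  dihedral_pair s t -> crossed (alt s t i) = mkseq (dihedral_root s t) i.
Proof.
move=> st; elim: i => [//|i ih].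
by rewrite alt_rcons -cats1 crossed_cat ih mkseqS -cats1 /= act_alt_root.
Qed.

Lemma crossed_braid s t :
  dihedral_pair s t -> crossed (alt t s k) = rev (crossed (alt s t k)).
Proof.
move=> st; rewrite !crossed_alt //; last exact: dihedral_pairC.
apply: (@eq_from_nth _ 0); rewrite ?size_rev !size_mkseq // => i ik.
rewrite nth_rev ?size_mkseq // !nth_mkseq //; last by rewrite subnSK ?leq_subr.
by rewrite /dihedral_root subnSK // !(qintB_half z_prim k_gt1) ?(ltnW ik) // addrC.
Qed.

Lemma act_alt_next s t : dihedral_pair s t ->
  act (alt s t k) (root (if odd k then t else s)) = - root s.
Proof.
move=> st; rewrite act_alt_root // /dihedral_root -[k.+1]addn1 -{2}[k]addn0.
rewrite !(qintD_half z_prim k_gt1) (qint1 z_prim k_gt1) qint0.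
by rewrite oppr0 scale0r addr0 scaleN1r.
Qed.

Lemma act_alt_last s t : dihedral_pair s t ->
  act (alt s t k) (root (if odd k then s else t)) = - root t.
Proof.
move=> st; have k_pred : k = k.-1.+1 by lia.
rewrite k_pred alt_rcons -cats1 act_cat /= if_neg refl_root linearN /= act_alt_root //.
rewrite /dihedral_root -k_pred -subn1 -{1}[k]subn0 !(qintB_half z_prim k_gt1) //.
  by rewrite qint0 (qint1 z_prim k_gt1) scale0r add0r scale1r.
exact: ltnW.
Qed.

Lemma act_alt_fixed s t i x :
  coroot s x = 0 -> coroot t x = 0 -> act (alt s t i) x = x.
Proof.
elim: i s t => [//|i ih] s t sx tx; rewrite altS /= ih //.
by rewrite /refl sx scale0r subr0.
Qed.

(* Cramer's rule: the Gram determinant of [root s], [root t] is [- (z - z^-1) ^+ 2]. *)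
Lemma dihedral_split s t x : dihedral_pair s t ->
  exists p q y, [/\ x = p *: root s + q *: root t + y, coroot s y = 0 & coroot t y = 0].
Proof.
case=> coroot_st coroot_ts; pose D := - (z - z^-1) ^+ 2.
pose p := (2 * coroot s x + (z + z^-1) * coroot t x) / D.
pose q := (2 * coroot t x + (z + z^-1) * coroot s x) / D.
exists p, q, (x - (p *: root s + q *: root t)); rewrite [_ + (x - _)]addrC subrK.
rewrite !(linearB, linearD, scalarZ) /= !coroot_root coroot_st coroot_ts.
have z_sqr_neq1 : z * z - 1 != 0.
  by rewrite -(divff z_neq0) -mulrBr mulf_neq0.
by rewrite /p /q /D; split=> //; field; rewrite z_neq0 oppr_eq0 expf_neq0.
Qed.

Lemma act_braid s t : dihedral_pair s t -> act (alt s t k) =1 act (alt t s k).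
Proof.
move=> st x; have ts := dihedral_pairC st.
have [p [q [y [-> sy ty]]]] := dihedral_split x st.
rewrite !(linearD, linearZ) /= (act_alt_fixed _ sy ty) (act_alt_fixed _ ty sy).
have := (act_alt_next st, act_alt_last st, act_alt_next ts, act_alt_last ts).
by case: (odd k) => -[[[-> ->] ->] ->].
Qed.

Lemma crossing_parity_braid a s t : dihedral_pair s t ->
  crossing_parity a (alt s t k) = crossing_parity a (alt t s k).
Proof. by move=> st; rewrite /crossing_parity (crossed_braid st) count_rev. Qed.

Lemma dihedral_functional s t i : dihedral_pair s t ->
  z * coroot s (dihedral_root s t i) + coroot t (dihedral_root s t i)
  = (z - z^-1) * z ^- i.
Proof.
case=> coroot_st coroot_ts; rewrite -(qint_expV z_prim k_gt1).
rewrite /dihedral_root !(linearD, scalarZ) /= !coroot_root coroot_st coroot_ts.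
by field.
Qed.

Lemma dihedral_root_inj s t i j : dihedral_pair s t -> (i < k)%N -> (j < k)%N ->
  up_to_sign (dihedral_root s t i) (dihedral_root s t j) -> j = i.
Proof.
move=> st ik jk /orP Dij; apply: (prim_root_expV_inj z_prim) => //.
have functional r := dihedral_functional r st.
case: Dij => /eqP Dij; [left|right]; apply: (mulfI zV_neq0).
  by rewrite -!functional Dij.
by rewrite mulrN -!functional Dij !linearN /= mulrN opprD.
Qed.

Lemma crossing_parity_alt s t i : dihedral_pair s t -> (i < k)%N ->
  crossing_parity (up_to_sign (dihedral_root s t i)) (alt s t k).
Proof.
move=> st ik; rewrite /crossing_parity crossed_alt // count_map.
rewrite (eq_in_count (a2 := pred1 i)) => [|j /=].
  by rewrite count_uniq_mem ?iota_uniq ?mem_iota ?ik.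
rewrite mem_iota => jk; apply/idP/eqP => [|->]; first exact: dihedral_root_inj.
by rewrite /up_to_sign eqxx.
Qed.

End Dihedral.

(** * The geometric representation of a Coxeter group *)

Section Coxeter.
Variables (m : S -> S -> option nat) (z : nat -> F).
Hypothesis m_gt1 : forall s t k, s != t -> m s t = Some k -> (1 < k)%N.
Hypothesis z_prim : forall k, (1 < k)%N -> (k.*2).-primitive_root (z k).
Hypothesis dihedral_m :
  forall s t k, s != t -> m s t = Some k -> dihedral_pair (z k) s t.

Lemma crossing_parity_weq a u v : sign_invariant a ->
  weq (coxeter_rel m) u v -> crossing_parity a u = crossing_parity a v.
Proof.
move=> a_sign; elim=> {u v} // [u v w _ -> //|u v e s|u v l r].
  exact: crossing_parity_square.
case=> [[s [t [k [st [mst [-> ->]]]]]]|[s [-> ->]]]; last exact: crossing_parity_square.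
have k_gt1 := m_gt1 st mst; have Dst := dihedral_m st mst.
apply: crossing_parity_ctx => // [|a' _]; first exact: (act_braid k_gt1 (z_prim k_gt1)).
exact: (crossing_parity_braid k_gt1 (z_prim k_gt1)).
Qed.

Lemma alt_le_word_dist s t k : s != t -> m s t = Some k ->
  (k <= word_dist (coxeter_rel m) [::] (alt s t k))%N.
Proof.
move=> st mst; have Dst := dihedral_m st mst.
have k_gt1 := m_gt1 st mst; have zk_prim := z_prim k_gt1.
pose D := dihedral_root (z k) s t; pose cut i := crossing_parity (up_to_sign (D i)).
have separation_k : separation cut (iota 0 k) [::] (alt s t k) = k.
  rewrite -[RHS](size_iota 0 k); apply/eqP; rewrite -all_count; apply/allP => i.
  by rewrite mem_iota; exact: crossing_parity_alt.
rewrite -[leqLHS]separation_k; apply: separation_le_word_dist => [i u v|w l].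
  exact/crossing_parity_weq/up_to_sign_invariant.
apply: count_le1 => [|i j]; first exact: iota_uniq.
rewrite !mem_iota /cut !crossing_parity_rcons !addbA !addbb => ik jk i_crossed.
by move/up_to_sign_common/(_ i_crossed)/(dihedral_root_inj k_gt1 zk_prim Dst jk ik).
Qed.

End Coxeter.
End Reflections.

Section GeometricRepresentation.
Variables (F : fieldType) (S : finType) (m : S -> S -> option nat) (z : nat -> F).

(* For [z k = exp (i pi / k)] this is [- 2 cos (pi / m s t)], with [pi / oo = 0]. *)
Definition cartan_coef s t : F :=
  if s == t then 2 else if m s t is Some k then - (z k + (z k)^-1) else - 2.

Definition simple_root s : {ffun S -> F^o} := [ffun t => (t == s)%:R].

Definition cartan_pairing s (x : {ffun S -> F^o}) : F := \sum_t x t * cartan_coef s t.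

Fact cartan_pairing_linear s : scalar (cartan_pairing s).
Proof.
move=> c x y; rewrite /cartan_pairing mulr_sumr -big_split; apply: eq_bigr => t _.
by rewrite !ffunE mulrDl mulrA.
Qed.

HB.instance Definition _ s :=
  GRing.isLinear.Build F {ffun S -> F^o} F *%R (cartan_pairing s)
    (cartan_pairing_linear s).

Definition simple_coroot s : {scalar {ffun S -> F^o}} := cartan_pairing s.

Lemma simple_coroot_root s t : simple_coroot s (simple_root t) = cartan_coef s t.
Proof.
rewrite /= /cartan_pairing (bigD1 t) //= ffunE eqxx mul1r big1 ?addr0 // => u.
by move=> /negbTE ut; rewrite ffunE ut mul0r.
Qed.

Lemma simple_dihedral_pair s t k : m s t = m t s -> s != t -> m s t = Some k ->
  dihedral_pair simple_root simple_coroot (z k) s t.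
Proof.
move=> mC st mst; split; rewrite simple_coroot_root /cartan_coef.
  by rewrite (negbTE st) mst.
by rewrite eq_sym (negbTE st) -mC mst.
Qed.

End GeometricRepresentation.

Lemma coxeter_alt_geodesic (S : finType) (m : S -> S -> option nat) s t k :
  coxeter_matrix m -> s != t -> m s t = Some k ->
  (k <= word_dist (coxeter_rel m) [::] (alt s t k))%N.
Proof.
move=> m_coxeter.
have [z z_prim] : exists z : nat -> algC,
    forall k, (1 < k)%N -> (k.*2).-primitive_root (z k).
  exists (fun k => sval (C_prim_root_exists (ltn0Sn (k.*2).-1))) => i i_gt1.
  by case: C_prim_root_exists => zi /=; rewrite prednK // double_gt0 ltnW.
have coroot_root s' : simple_coroot m z s' (simple_root algC s') = 2.
  by rewrite simple_coroot_root /cartan_coef eqxx.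
apply: (alt_le_word_dist coroot_root (proj2 m_coxeter) z_prim) => s' t' k'.
exact/simple_dihedral_pair/(proj1 m_coxeter).
Qed.

(** * Quadrilaterals *)

Lemma alternating_form4 (C : numClosedFieldType) (d : nat -> nat -> nat) :
  (forall i, d i i = 0%N) -> (forall i j, d i j = d j i) ->
  \sum_(i < 4) \sum_(j < 4) (-1) ^+ i * ((-1) ^+ j)^* * (d i j)%:R
  = 2 * (d 0 2 + d 1 3)%:R - 2 * (d 0 1 + d 1 2 + d 2 3 + d 0 3)%:R :> C.
Proof.
move=> d_diag dC; under eq_bigr do under eq_bigr do rewrite rmorphXn rmorphN1.
rewrite !big_ord_recl !big_ord0 /= /bump /= !add1n !d_diag !natrD.
by rewrite (dC 1 0) (dC 2 0) (dC 3 0) (dC 2 1) (dC 3 1) (dC 3 2); ring.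
Qed.

Lemma CSND_quadrilateral (S : finType) (R : rels S) (x0 x1 x2 x3 : word S) :
  word_metric_CSND R ->
  pairwise (fun x y => word_dist R x y != 0%N) [:: x0; x1; x2; x3] ->
  (word_dist R x0 x2 + word_dist R x1 x3
   < word_dist R x0 x1 + word_dist R x1 x2 + word_dist R x2 x3 + word_dist R x0 x3)%N.
Proof.
move=> csnd x_apart; pose x i := nth [::] [:: x0; x1; x2; x3] i.
pose d i j := word_dist R (x i) (x j).
have x_distinct (i j : 'I_4) : i != j -> ~ weq R (x i) (x j).
  wlog ij : i j / (i < j)%N => [wlog_lt|_ /word_dist_weq0/eqP].
    move=> /[dup] ij; rewrite neq_ltn => /orP[lt_ij|lt_ji]; first exact: wlog_lt.
    by move/weq_sym; apply: wlog_lt; rewrite 1?eq_sym.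
  by apply/negP; move/(pairwiseP [::]): x_apart; apply => //; exact: ltn_ord.
have sum_weights : \sum_(i < 4) (-1) ^+ i = 0 :> Cx.
  by rewrite !big_ord_recl big_ord0 /= /bump /=; ring.
have := csnd 4 (fun i => x i) (fun i => (-1) ^+ i) x_distinct sum_weights.
rewrite (alternating_form4 _ (d := d)) => [|i|i j].
- rewrite subr_lt0 ltr_pM2l ?ltr0n // ltr_nat; apply.
  by exists ord0; rewrite expr0 oner_eq0.
- exact: word_distxx.
- exact: word_distC.
Qed.

Lemma geodesic_rectangle_not_CSND (S : finType) (R : rels S) (x0 x1 x2 x3 : word S)
    a b :
  (0 < a)%N -> (0 < b)%N ->
  (word_dist R x0 x1 <= a)%N -> (word_dist R x1 x2 <= b)%N ->
  (word_dist R x2 x3 <= a)%N -> (word_dist R x0 x3 <= b)%N ->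
  (a + b <= word_dist R x0 x2)%N -> (a + b <= word_dist R x1 x3)%N ->
  ~ word_metric_CSND R.
Proof.
move=> a_gt0 b_gt0 d01 d12 d23 d03 d02 d13 csnd.
have := @CSND_quadrilateral _ _ x0 x1 x2 x3 csnd; rewrite /= !andbT.
have := word_dist_triangle R x1 x0 x2; have := word_dist_triangle R x3 x0 x2.
have := word_dist_triangle R x0 x1 x3; have := word_dist_triangle R x2 x1 x3.
rewrite [word_dist R x1 x0]word_distC [word_dist R x3 x2]word_distC.
lia.
Qed.

(* The rectangle [1], [s], [stst...], [tsts...], the last two of lengths [k] and [k.-1],
   consists of two pairs of antipodes of the [2k]-cycle spanned by [s] and [t]. *)
Lemma finite_coefficient_not_CSND (S : finType) (m : S -> S -> option nat) (R : rels S)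
    s t k :
  coxeter_matrix m -> sub_rels (artin_rel m) R -> sub_rels R (coxeter_rel m) ->
  s != t -> m s t = Some k -> ~ word_metric_CSND R.
Proof.
move=> m_coxeter artinR Rcoxeter st mst.
have k_gt1 := proj2 m_coxeter _ _ _ st mst.
case: k => [//|k] in k_gt1 mst *.
have braid : weq R (alt s t k.+1) (alt t s k.+1).
  suff /(weq_rel [::] [::]) : R (alt s t k.+1) (alt t s k.+1) by rewrite !cats0.
  by apply: artinR; exists s, t, k.+1.
have alt_far : (k < word_dist (coxeter_rel m) [::] (alt s t k.+1))%N.
  exact: coxeter_alt_geodesic.
have dist_alt x y : weq R (x ++ alt t s k) y -> (word_dist R x y <= k)%N.
  by move/word_dist_le; rewrite size_alt.
apply: (@geodesic_rectangle_not_CSND _ R [::] [:: (false, s)] (alt s t k.+1) (alt t s k)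
  1 k) => //.
- by apply: (word_dist_le (w := [:: _])); exact: weq_refl.
- by apply: dist_alt; rewrite altS; exact: weq_refl.
- rewrite word_distC; apply: (word_dist_le (w := [:: (false, if odd k then s else t)])).
  by rewrite cats1 -alt_rcons; exact: weq_sym.
- by apply: dist_alt; exact: weq_refl.
- exact: leq_trans alt_far (word_dist_mono _ _ Rcoxeter).
- apply: leq_trans (word_dist_mono _ _ Rcoxeter).
  rewrite -(word_dist_catl _ [:: (false, s)]) -[_ ++ alt t s k]altS.
  by rewrite (word_dist_weq (weq_generator_sqr m s) (weq_refl _ _)).
Qed.

Lemma CSND_all_infinite (S : finType) (m : S -> S -> option nat) (R : rels S) :
  coxeter_matrix m -> sub_rels (artin_rel m) R -> sub_rels R (coxeter_rel m) ->
  word_metric_CSND R -> all_infinite m.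
Proof.
move=> m_coxeter artinR Rcoxeter csnd s t st; case mst: (m s t) => [k|//].
by case: (finite_coefficient_not_CSND m_coxeter artinR Rcoxeter st mst).
Qed.

Theorem theorem2 (S : finType) (m : S -> S -> option nat) :
  coxeter_matrix m ->
  (word_metric_CSND (coxeter_rel m) <-> all_infinite m) /\
  (word_metric_CSND (artin_rel m) <-> all_infinite m).
Proof.
move=> m_coxeter; have artin_coxeter : sub_rels (artin_rel m) (coxeter_rel m).
  by move=> l r; left.
split; split.
- exact: CSND_all_infinite.
- exact: free_coxeter_CSND.
- exact: CSND_all_infinite.
- exact: free_artin_CSND.
Qed.
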